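(* (i) Let $S$ be a set of $n$ points in the plane, not all on a line. Then the number of triangles with vertices in $S$ whose area equals the minimum nonzero area among all triangles with vertices in $S$ is at most $\frac{2}{3}(n^2-n)$. (ii) For $n\ge 1$ let $G_n=\{1,2,\dots,\lfloor\sqrt n\rfloor\}^2\subset\mathbb{R}^2$ (a set of at most $n$ points). Then the number of triangles with vertices in $G_n$ whose area equals the minimum nonzero area among triangles with vertices in $G_n$ is at least $\left(\frac{6}{\pi^2}-o(1)\right)n^2$, where $o(1)$ denotes a quantity tending to $0$ as $n\to\infty$.
   Context: A triangle spanned by a point set is an unordered triple of its points; collinear triples (area $0$) are allowed in the set but are not counted, and the minimum is over triangles of positive area. *)

(* Defs.v *)
From mathcomp Require Import all_boot all_order all_algebra finmap.
From mathcomp Require Import all_classical all_reals all_analysis.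

Set Implicit Arguments.
Unset Strict Implicit.
Unset Printing Implicit Defensive.

Import Order.TTheory GRing.Theory Num.Theory.
Import numFieldNormedType.Exports.

Local Open Scope fset_scope.
Local Open Scope ring_scope.

Definition area (R : realType) (p q r : R * R) : R :=
  `|(q.1 - p.1) * (r.2 - p.2) - (r.1 - p.1) * (q.2 - p.2)| / 2.

(* Since [area] is invariant under permutations, the value on a three-element
   set does not depend on the enumeration; the default 0 is only reached on
   sets that do not have exactly three elements. *)
Definition triangle_area (R : realType) (T : {fset R * R}) : R :=
  if enum_fset T is [:: p; q; r] then area p q r else 0.

Definition nondeg_triangles (R : realType) (S : {fset R * R}) :
    {fset {fset R * R}} :=
  [fset T in fpowerset S | (#|` T| == 3%N) && (0 < triangle_area T)].

Definition min_area_triangles (R : realType) (S : {fset R * R}) :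
    {fset {fset R * R}} :=
  [fset T in nondeg_triangles S |
    [forall T' : nondeg_triangles S, triangle_area T <= triangle_area (fsval T')]].

Definition on_a_line (R : realType) (S : {fset R * R}) : Prop :=
  exists a b c : R, (a, b) <> (0, 0) /\
    forall p : R * R, p \in S -> a * p.1 + b * p.2 = c.

(* [Num.truncn] is the floor, as a natural number, of a nonnegative real. *)
Definition grid (R : realType) (n : nat) : {fset R * R} :=
  let k := Num.truncn (Num.sqrt (n%:R : R)) in
  [fset ((i%:R, j%:R) : R * R) | i in iota 1 k, j in iota 1 k].

(* Main.v *)
(** (i) Fix two parallel lines spanned by the set (the second one possibly through
    a single point) with no point strictly between them, containing k and m
    points.  A minimum area triangle with a side on one of them and the opposite
    vertex on the other has two consecutive points as that side, so there are at
    most (k-1)m + (m-1)k <= k(k-1) + m(m-1) of them.  Every spanned line has at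
    most one such neighbour on each side, so summing over all pairs of
    neighbours, each ordered pair of points is counted at most twice, and each
    triangle is counted three times, once per side: 3t <= 2n(n-1).

    (ii) If (x, y) is primitive with x, y > 0, each diagonal of an x by y grid
    box spans two triangles of area 1/2 with a third lattice point of the box,
    and a triangle determines its box and diagonal.  So the k by k grid has at
    least 4 F(k) minimum area triangles, where F(t) is the sum of (t-x)(t-y) over
    coprime x, y < t.  Sorting all pairs by their gcd gives
    sum_g g^2 F(t/g) = t^4/4 + O(t^3); since 1/4 + 1/9 + ... < 1, this relation
    contracts the error in F(t) ~ t^4 / (4 zeta(2)).  Finally zeta(2) = pi^2/6 by
    iterating 4 / sin^2(2x) = 1 / sin^2 x + 1 / cos^2 x from x = pi/4. *)

Require Import Defs.
From mathcomp Require Import all_boot all_order all_algebra finmap.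
From mathcomp Require Import all_classical all_reals all_analysis.
From mathcomp Require Import zify ring lra.

Set Implicit Arguments.
Unset Strict Implicit.
Unset Printing Implicit Defensive.

Import Order.TTheory GRing.Theory Num.Theory.
Import numFieldNormedType.Exports.

Local Open Scope classical_set_scope.
Local Open Scope fset_scope.
Local Open Scope ring_scope.

(** * The sum of inverse squares *)

Section Basel.
Variable R : realType.
Implicit Types (x : R) (n m k N M : nat).

Lemma sin_le_id x : 0 <= x -> sin x <= x.
Proof.
move=> x0; rewrite -subr_ge0.
pose f y : R := y - sin y.
have df (y : R) : is_derive y (1 : R) (f : R -> R) (1 - cos y) by apply: is_deriveB.
have : f 0 <= f x.
  apply: (@ger0_derive1_le_cc R f 0 x) => //.
  - by move=> y _; rewrite derive1E derive_val subr_ge0 cos_le1.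
  - by apply: derivable_within_continuous => y _; apply: ex_derive.
  - by rewrite in_itv /= lexx.
  - by rewrite in_itv /= x0 lexx.
by rewrite /f sin0 subrr.
Qed.

Lemma id_le_tan x : 0 <= x < pi / 2 -> x <= tan x.
Proof.
case/andP=> x0 xpi; rewrite -subr_ge0.
pose f y : R := tan y - y.
have cosn y : 0 <= y <= x -> cos y != 0.
  move=> /andP[y0 yx]; apply: lt0r_neq0; apply: cos_gt0_pihalf.
  have := pi_gt0 R; lra.
have df (y : R) : 0 <= y <= x -> is_derive y (1 : R) (f : R -> R) ((cos y)^-2 - 1).
  by move=> yx; apply: is_deriveB; apply: is_derive_tan; apply: cosn.
have : f 0 <= f x.
  apply: (@ger0_derive1_le_cc R f 0 x) => //.
  - move=> y; rewrite in_itv /= => /andP[y0 yx].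
    have /df? : 0 <= y <= x by rewrite !ltW.
    exact: ex_derive.
  - move=> y; rewrite in_itv /= => /andP[y0 yx].
    have yx' : 0 <= y <= x by rewrite !ltW.
    have ? := df _ yx'.
    rewrite derive1E derive_val cos2_tan2 ?cosn//.
    by rewrite addrAC subrr add0r sqr_ge0.
  - apply: derivable_within_continuous => y; rewrite in_itv /= => /df ?.
    exact: ex_derive.
  - by rewrite in_itv /= lexx.
  - by rewrite in_itv /= x0 lexx.
by rewrite /f tan0 subrr.
Qed.

(** From sin x <= x <= tan x, since 1 / tan^2 x = 1 / sin^2 x - 1. *)
Lemma inv_sqr_bounds x : 0 < x < pi / 2 ->
  (sin x ^+ 2)^-1 - 1 <= (x ^+ 2)^-1 <= (sin x ^+ 2)^-1.
Proof.
move=> xpi; have /andP[x0 x1] := xpi.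
have s0 : 0 < sin x by apply: sin_gt0_pihalf.
have c0 : 0 < cos x by apply: cos_gt0_pihalf; lra.
apply/andP; split; last first.
  rewrite lef_pV2 ?posrE ?exprn_gt0//.
  by rewrite lerXn2r ?nnegrE ?(ltW s0) ?(ltW x0)// sin_le_id// ltW.
have -> : (sin x ^+ 2)^-1 - 1 = (tan x ^+ 2)^-1.
  rewrite /tan; apply: (@mulIf _ (sin x ^+ 2)).
    by rewrite expf_neq0// lt0r_neq0.
  have := cos2Dsin2 x; move: (lt0r_neq0 s0) (lt0r_neq0 c0).
  set s := sin x; set c := cos x => sn cn cs.
  have -> : ((s / c) ^+ 2)^-1 * s ^+ 2 = c ^+ 2 by field; rewrite sn cn.
  have -> : ((s ^+ 2)^-1 - 1) * s ^+ 2 = 1 - s ^+ 2 by field.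
  by rewrite -cs; ring.
have t0 : 0 < tan x by rewrite /tan divr_gt0.
rewrite lef_pV2 ?posrE ?exprn_gt0//.
by rewrite lerXn2r ?nnegrE ?(ltW t0) ?(ltW x0)// id_le_tan// x1 ltW.
Qed.

(* Halving the angle turns a sum of [1 / sin^2] over [2 ^ n] odd multiples of
   [pi / 2 ^ (n + 2)] into the same kind of sum at level [n + 1]. *)
Definition dyadic_odd_angle n k : R := k.*2.+1%:R * pi / (2 ^ n.+2)%:R.

Lemma dyadic_odd_angle_range n k : (k < 2 ^ n)%N ->
  0 < dyadic_odd_angle n k < pi / 2.
Proof.
move=> kn; rewrite /dyadic_odd_angle; have pi0 := pi_gt0 R.
have p0 : (0 : R) < (2 ^ n.+2)%:R by rewrite ltr0n expn_gt0.
apply/andP; split; first by rewrite divr_gt0 // mulr_gt0 // ltr0n.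
have h : k.*2.+1%:R * 2 < (2 ^ n.+2)%:R :> R.
  by rewrite -natrM ltr_nat !expnS; lia.
rewrite ltr_pdivrMr //; nra.
Qed.

Lemma inv_sin_sqr_double x : sin x != 0 -> cos x != 0 ->
  (sin x ^+ 2)^-1 + (cos x ^+ 2)^-1 = 4 * (sin (x *+ 2) ^+ 2)^-1.
Proof.
move=> s0 c0; rewrite sin_mulr2n.
transitivity ((cos x ^+ 2 + sin x ^+ 2) / (sin x * cos x) ^+ 2).
  by field; rewrite s0 c0.
by rewrite cos2Dsin2; field; rewrite s0 c0.
Qed.

Lemma sum_inv_sin_sqr n :
  \sum_(k < 2 ^ n) (sin (dyadic_odd_angle n k) ^+ 2)^-1 = 2 * 4 ^+ n :> R.
Proof.
elim: n => [|n IH].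
  (* The only angle is pi / 4; its sine equals its cosine, so sin (pi / 2) = 1 forces sin^2 = 1 /
     2. *)
  rewrite big_ord1 /dyadic_odd_angle /= mul1r.
  have := sin_mulr2n (pi / (2 ^ 2)%:R : R).
  have -> : (pi / (2 ^ 2)%:R) *+ 2 = pi / 2 :> R by rewrite -mulr_natr; field.
  have := cosBpihalf (pi / (2 ^ 2)%:R : R).
  have -> : pi / (2 ^ 2)%:R - pi / 2 = - (pi / (2 ^ 2)%:R) :> R by field.
  rewrite cosN sin_pihalf => ->.
  set s := sin _ => h; have hs : s ^+ 2 = 2^-1 by lra.
  by rewrite hs invrK mulr1.
rewrite expnS mul2n -addnn big_split_ord /=.
(* Reversing the upper half pairs each angle x with pi / 2 - x, whose sine is cos x. *)
rewrite [X in _ + X](reindex_inj rev_ord_inj) /= -big_split /=.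
rewrite [RHS](_ : _ = 4 * (2 * 4 ^+ n)); last by rewrite exprS; ring.
rewrite -IH mulr_sumr; apply: eq_bigr => k _.
set x := dyadic_odd_angle n.+1 k.
have pi0 : (pi : R) != 0 by rewrite lt0r_neq0 ?pi_gt0.
have p0 : (2 ^ n.+2)%:R != 0 :> R by rewrite pnatr_eq0 expn_eq0.
have -> : dyadic_odd_angle n k = x *+ 2.
  rewrite /x /dyadic_odd_angle -[RHS]mulr_natr (expnS _ n.+2) natrM.
  by field; rewrite p0.
have -> : dyadic_odd_angle n.+1 (2 ^ n + (2 ^ n - k.+1)) = pi / 2 - x.
  rewrite /x /dyadic_odd_angle.
  have -> : (2 ^ n + (2 ^ n - k.+1)).*2.+1 = (2 ^ n.+2 - k.*2.+1)%N.
    by have := ltn_ord k; rewrite !expnS; lia.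
  rewrite natrB; last by have := ltn_ord k; rewrite !expnS; lia.
  by rewrite (expnS _ n.+2) natrM; field; rewrite p0.
have xr : 0 < x < pi / 2.
  apply: dyadic_odd_angle_range; rewrite expnS; have := ltn_ord k; lia.
rewrite sinB sin_pihalf cos_pihalf mul1r mul0r subr0.
rewrite inv_sin_sqr_double //; first by rewrite lt0r_neq0 ?sin_gt0_pihalf.
by rewrite lt0r_neq0 ?cos_gt0_pihalf//; have := pi_gt0 R; lra.
Qed.

(** The bounds of [inv_sqr_bounds] differ by 1 per term, hence by 2^n against a total of 2 * 4^n;
    rescaling by pi^2 / (16 * 4^n) makes this loss O(2^-n). *)
Lemma sum_inv_odd_sqr n :
  (pi : R) ^+ 2 / 8 - (pi : R) ^+ 2 / 16 * (2 ^ n)%:R^-1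
    <= \sum_(k < 2 ^ n) (k.*2.+1%:R ^+ 2)^-1 <= (pi : R) ^+ 2 / 8.
Proof.
have p2 : (0 : R) < pi ^+ 2 by rewrite exprn_gt0 ?pi_gt0.
set O := \sum_(k < _) _.
have p0 : (0 : R) < (2 ^ n)%:R by rewrite ltr0n expn_gt0.
have e4 : (4 : R) ^+ n = (2 ^ n)%:R ^+ 2.
  by rewrite natrX -exprM mulnC exprM; congr (_ ^+ n); ring.
have E : O = pi ^+ 2 / (16 * 4 ^+ n) *
             \sum_(k < 2 ^ n) (dyadic_odd_angle n k ^+ 2)^-1.
  rewrite mulr_sumr; apply: eq_bigr => k _; rewrite /dyadic_odd_angle.
  have pi0 : (pi : R) != 0 by rewrite lt0r_neq0 ?pi_gt0.
  rewrite e4.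
  have k0 : k.*2.+1%:R != 0 :> R by rewrite pnatr_eq0.
  rewrite !expnS !natrM; move: (lt0r_neq0 p0) k0 pi0.
  move: (pi : R) (2 ^ n)%:R k.*2.+1%:R => p a b a0 b0 pi0.
  by field; rewrite pi0 a0 b0.
have q0 : (0 : R) < pi ^+ 2 / (16 * 4 ^+ n).
  by rewrite divr_gt0 // mulr_gt0 // ?exprn_gt0.
have lo : 2 * 4 ^+ n - (2 ^ n)%:R <=
    \sum_(k < 2 ^ n) (dyadic_odd_angle n k ^+ 2)^-1.
  rewrite -sum_inv_sin_sqr -[(2 ^ n)%:R]/(1 *+ (2 ^ n)).
  rewrite -[in X in _ *+ X](card_ord (2 ^ n)) -sumr_const -sumrB.
  apply: ler_sum => k _.
  by have /andP[] := inv_sqr_bounds (dyadic_odd_angle_range (ltn_ord k)).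
have hi : \sum_(k < 2 ^ n) (dyadic_odd_angle n k ^+ 2)^-1 <= 2 * 4 ^+ n.
  rewrite -sum_inv_sin_sqr; apply: ler_sum => k _.
  by have /andP[] := inv_sqr_bounds (dyadic_odd_angle_range (ltn_ord k)).
rewrite E; apply/andP; split.
  apply: le_trans (ler_wpM2l (ltW q0) lo).
  rewrite e4; move: (lt0r_neq0 p0); set a := (2 ^ n)%:R => a0.
  by rewrite le_eqVlt; apply/orP; left; apply/eqP; field.
apply: le_trans (ler_wpM2l (ltW q0) hi) _.
rewrite e4; move: (lt0r_neq0 p0); set a := (2 ^ n)%:R => a0.
by rewrite le_eqVlt; apply/orP; left; apply/eqP; field.
Qed.

Definition sum_inv_sqr N : R := \sum_(1 <= g < N.+1) (g%:R ^+ 2)^-1.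

Lemma sum_inv_sqrS N : sum_inv_sqr N.+1 = sum_inv_sqr N + (N.+1%:R ^+ 2)^-1.
Proof. by rewrite /sum_inv_sqr big_nat_recr. Qed.

Lemma sum_inv_sqr_le N M : (N <= M)%N -> sum_inv_sqr N <= sum_inv_sqr M.
Proof.
move=> /subnK <-; elim: (M - N)%N => [|d IH] //.
rewrite addSn sum_inv_sqrS; apply: le_trans IH _.
by rewrite lerDl invr_ge0 exprn_ge0.
Qed.

(** Telescoping: 1 / (m + 1)^2 <= 1 / m - 1 / (m + 1). *)
Lemma sum_inv_sqrD_le N M : (0 < N <= M)%N ->
  sum_inv_sqr M + M%:R^-1 <= sum_inv_sqr N + N%:R^-1.
Proof.
case/andP=> N0 /subnK <-; elim: (M - N)%N => [|d IH] //.
rewrite addSn sum_inv_sqrS; apply: le_trans IH; rewrite -addrA lerD2l.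
set k := (d + N)%N; have k0 : (0 : R) < k%:R by rewrite ltr0n /k; lia.
rewrite -natr1; set x : R := k%:R in k0 *.
have x1 : 0 < x + 1 by lra.
rewrite -subr_ge0.
have -> : x^-1 - (((x + 1) ^+ 2)^-1 + (x + 1)^-1) = (x * (x + 1) ^+ 2)^-1.
  by field; rewrite !lt0r_neq0.
by rewrite invr_ge0 mulr_ge0 ?exprn_ge0 ?ltW.
Qed.

Lemma sum_inv_sqr_double M :
  sum_inv_sqr M.*2 =
    \sum_(k < M) (k.*2.+1%:R ^+ 2)^-1 + sum_inv_sqr M / 4.
Proof.
elim: M => [|M IH]; first by rewrite /sum_inv_sqr big_ord0 !big_geq // mul0r addr0.
rewrite doubleS !sum_inv_sqrS IH big_ord_recr /=.
have -> : M.*2.+2%:R = 2 * M.+1%:R :> R by rewrite -doubleS -mul2n natrM.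
have M0 : M.+1%:R != 0 :> R by rewrite pnatr_eq0.
have M1 : M.*2.+1%:R != 0 :> R by rewrite pnatr_eq0.
move: M0 M1; move: (M.+1%:R : R) (M.*2.+1%:R : R) (sum_inv_sqr M) => a b z a0 b0.
by field; rewrite a0 b0.
Qed.

(** Write S for [sum_inv_sqr]. Removing the even terms S(M) / 4 from S(2M) leaves an odd sum, close
    to pi^2 / 8 when M = 2^n; as S(2M) and S(M) differ by at most 1 / M, S tends to 4/3 of pi^2 / 8.
    Monotonicity and telescoping carry this back to [N]. *)
Lemma basel_bounds N : (0 < N)%N ->
  sum_inv_sqr N <= pi ^+ 2 / 6 <= sum_inv_sqr N + N%:R^-1.
Proof.
move=> N0.
have p2 : (0 : R) < pi ^+ 2 by rewrite exprn_gt0 ?pi_gt0.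
have dbl n : sum_inv_sqr (2 ^ n).*2 =
    \sum_(k < 2 ^ n) (k.*2.+1%:R ^+ 2)^-1 + sum_inv_sqr (2 ^ n) / 4.
  exact: sum_inv_sqr_double.
apply/andP; split.
  have NN : (N <= 2 ^ N)%N by rewrite ltnW // ltn_expl.
  apply: le_trans (sum_inv_sqr_le NN) _.
  have := dbl N; have /andP[_ h] := sum_inv_odd_sqr N.
  have : sum_inv_sqr (2 ^ N) <= sum_inv_sqr (2 ^ N).*2.
    by apply: sum_inv_sqr_le; rewrite -addnn leq_addr.
  by lra.
rewrite leNgt; apply/negP => lt0.
pose d := pi ^+ 2 / 6 - (sum_inv_sqr N + N%:R^-1).
have d0 : 0 < d by rewrite subr_gt0.
(* 4/3 times the two losses at M = 2^n, in units of 1 / M: pi^2 / 16 in the odd sum and 1 in S(2M)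
   <= S(M) + 1 / M. Thus d <= C / 2^n, against the choice of [n]. *)
pose C : R := pi ^+ 2 / 12 + 4 / 3.
pose n := (N + Num.truncn (C / d))%N.
have Cn : C / d < (2 ^ n)%:R.
  apply: lt_le_trans (truncnS_gt _) _; rewrite ler_nat.
  by apply: leq_ltn_trans (ltn_expl n (ltnSn 1)); rewrite /n leq_addl.
have NN : (0 < N <= 2 ^ n)%N.
  rewrite N0 /=; apply: ltnW; apply: leq_ltn_trans (ltn_expl n (ltnSn 1)).
  by rewrite /n leq_addr.
have h1 := sum_inv_sqrD_le NN.
have /andP[h2 _] := sum_inv_odd_sqr n.
have h3 := dbl n.
have p0 : (0 : R) < (2 ^ n)%:R by rewrite ltr0n expn_gt0.
have h4 : sum_inv_sqr (2 ^ n).*2 <= sum_inv_sqr (2 ^ n) + (2 ^ n)%:R^-1.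
  have : (0 < 2 ^ n <= (2 ^ n).*2)%N by rewrite expn_gt0 -addnn leq_addr.
  move/sum_inv_sqrD_le; apply: le_trans; rewrite lerDl invr_ge0; exact: ler0n.
have : d <= C * (2 ^ n)%:R^-1.
  have i0 : 0 < (2 ^ n)%:R^-1 :> R by rewrite invr_gt0.
  rewrite /d /C; move: h1 h2 h3 h4 i0; set z := (2 ^ n)%:R^-1; nra.
move: Cn; rewrite ltr_pdivrMr // => Cn; rewrite ler_pdivlMr // => h.
by lra.
Qed.

End Basel.

(** * Weighted count of coprime pairs *)

Section CoprimeWeight.
Variable R : realType.
Implicit Types (t a eps : R) (N M g x y k : nat).

Definition coprime_pos (p : nat * nat) : bool :=
  [&& 0 < p.1, 0 < p.2 & coprime p.1 p.2]%N.

(** The cutoff at 0 discards all x >= t, so one index bound [N] serves all arguments t / g at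
    once. *)
Definition tent t x : R := Num.max 0 (t - x%:R).

(** For t <= N this is F(t) of the overview, extended to real t because the recursion evaluates it
    at t / g. *)
Definition coprime_weight N t : R :=
  \sum_(p : 'I_N.+1 * 'I_N.+1 | coprime_pos (p.1 : nat, p.2 : nat))
    tent t p.1 * tent t p.2.

Definition tent_sum N t : R := \sum_(x < N.+1 | (0 < x)%N) tent t x.

Lemma tent_ge0 t x : 0 <= tent t x.
Proof. by rewrite le_max lexx. Qed.

Lemma tent_eq0 t x : t <= x%:R -> tent t x = 0.
Proof. by move=> tx; apply/max_idPl; rewrite subr_le0. Qed.

Lemma tent_scale t g x : (0 < g)%N -> g%:R * tent (t / g%:R) x = tent t (g * x).
Proof.
move=> g0; have g0' : (0 : R) < g%:R by rewrite ltr0n.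
rewrite /tent maxr_pMr ?ltW // mulr0; congr (Num.max _ _).
by rewrite natrM; field; rewrite lt0r_neq0.
Qed.

(* Every pair of positive integers is uniquely [(g x, g y)] with [x], [y]
   coprime. *)
Lemma sum_by_gcd N (w : nat -> R) : (forall m, (N < m)%N -> w m = 0) ->
  (\sum_(u < N.+1 | (0 < u)%N) w u) ^+ 2 =
  \sum_(g < N.+1 | (0 < g)%N)
    \sum_(p : 'I_N.+1 * 'I_N.+1 | coprime_pos (p.1 : nat, p.2 : nat))
      w (g * p.1)%N * w (g * p.2)%N.
Proof.
move=> w0; rewrite expr2 big_distrlr /= pair_big /= pair_big /=.
pose P (q : 'I_N.+1 * ('I_N.+1 * 'I_N.+1)) :=
  [&& (0 < q.1)%N, coprime_pos (q.2.1 : nat, q.2.2 : nat),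
      (q.1 * q.2.1 <= N)%N & (q.1 * q.2.2 <= N)%N].
(* Where g x or g y exceeds [N] the summand vanishes; on the remaining indices [h] and [h'] are
   mutually inverse and every [inord] is in range. *)
rewrite [RHS](bigID P) /= [X in _ = _ + X]big1 ?addr0; last first.
  move=> [g [x y]] /= /andP[/andP[g0 cxy]]; rewrite /P /= g0 cxy /= negb_and.
  by rewrite -!ltnNge => /orP[] /w0 ->; rewrite ?mul0r ?mulr0.
pose h (j : 'I_N.+1 * 'I_N.+1) : 'I_N.+1 * ('I_N.+1 * 'I_N.+1) :=
  let g := gcdn j.1 j.2 in (inord g, (inord (j.1 %/ g)%N, inord (j.2 %/ g)%N)).
pose h' (i : 'I_N.+1 * ('I_N.+1 * 'I_N.+1)) : 'I_N.+1 * 'I_N.+1 :=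
  (inord (i.1 * i.2.1)%N, inord (i.1 * i.2.2)%N).
rewrite [RHS](reindex_onto h h'); last first.
  move=> [g [x y]]; rewrite /P /h /h' /coprime_pos /=.
  move=> /andP[_] /and3P[g0 /and3P[x0 y0 cxy] /andP[gx gy]].
  rewrite !inordK ?ltnS // -muln_gcdr (eqP cxy) muln1 !mulKn //.
  by rewrite !inord_val.
have hv u v : (0 < u <= N)%N -> (0 < v <= N)%N ->
    [/\ (0 < gcdn u v <= N)%N, (0 < u %/ gcdn u v <= N)%N,
        (0 < v %/ gcdn u v <= N)%N, (gcdn u v * (u %/ gcdn u v) = u)%N &
        (gcdn u v * (v %/ gcdn u v) = v)%N].
  move=> /andP[u0 uN] /andP[v0 vN].
  have g0 : (0 < gcdn u v)%N by rewrite gcdn_gt0 u0.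
  have e1 : (gcdn u v * (u %/ gcdn u v) = u)%N by rewrite mulnC divnK ?dvdn_gcdl.
  have e2 : (gcdn u v * (v %/ gcdn u v) = v)%N by rewrite mulnC divnK ?dvdn_gcdr.
  split=> //.
  - by rewrite g0 /=; apply: leq_trans uN; rewrite dvdn_leq ?dvdn_gcdl.
  - by rewrite divn_gt0 // dvdn_leq ?dvdn_gcdl //= (leq_trans (leq_div _ _)).
  - by rewrite divn_gt0 // dvdn_leq ?dvdn_gcdr //= (leq_trans (leq_div _ _)).
apply: eq_big => [[u v] | [u v] /= /andP[u0 v0]]; last first.
  have [|| /andP[g0 gN] /andP[x0 xN] /andP[y0 yN] e1 e2] := hv u v.
  - by rewrite u0 -ltnS /=.
  - by rewrite v0 -ltnS /=.
  by rewrite !inordK // e1 e2.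
have [/andP[u0 v0] | uv0] := boolP ((0 < u) && (0 < v))%N; last first.
  apply/esym/negbTE; apply: contra uv0.
  move=> /andP[/andP[_]]; move: (h (u, v)) => q; rewrite /P /coprime_pos /h' /=.
  move=> /and3P[g0 /and3P[x0 y0 _] /andP[gx gy]] /eqP[].
  move=> /(congr1 (@nat_of_ord _)) + /(congr1 (@nat_of_ord _)).
  by rewrite /= !inordK ?ltnS // => <- <-; rewrite !muln_gt0 g0 x0 y0.
have [|| /andP[g0 gN] /andP[x0 xN] /andP[y0 yN] e1 e2] := hv u v.
- by rewrite u0 -ltnS /=.
- by rewrite v0 -ltnS /=.
rewrite /P /h /h' /coprime_pos /= !inordK ?ltnS // e1 e2 g0 x0 y0.
have uN : (u <= N)%N by rewrite -ltnS.
have vN : (v <= N)%N by rewrite -ltnS.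
rewrite uN vN !inord_val eqxx.
suff -> : coprime (u %/ gcdn u v) (v %/ gcdn u v) by [].
by rewrite /coprime -(eqn_pmul2l g0) muln_gcdr e1 e2 muln1.
Qed.

Lemma tent_sum_le1 N t : t <= 1 -> tent_sum N t = 0.
Proof.
move=> t1; rewrite /tent_sum big1 // => x x0; apply: tent_eq0.
by apply: le_trans t1 _; rewrite ler1n.
Qed.

Lemma tent_sumS N t : tent_sum N.+1 t = tent t 1 + tent_sum N (t - 1).
Proof.
rewrite /tent_sum big_mkcond big_ord_recl /= add0r big_ord_recl /=.
congr (_ + _); rewrite [RHS]big_mkcond /= [RHS]big_ord_recl /= add0r.
apply: eq_bigr => i _; rewrite /tent /bump /= !add1n.
by rewrite -[i.+2%:R]natr1 opprD addrA addrAC.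
Qed.

(** Removing x = 1 turns t into t - 1, which suits an induction on [N]; for t <= 1 the sum
    vanishes. *)
Lemma tent_sum_bounds N t : 0 <= t <= N%:R ->
  (t ^+ 2 - t) / 2 <= tent_sum N t <= t ^+ 2 / 2.
Proof.
elim: N t => [|N IH] t tN.
  have -> : t = 0 by lra.
  by rewrite tent_sum_le1 //; lra.
have [t1 | t1] := leP t 1; first by rewrite tent_sum_le1 //; nra.
rewrite tent_sumS; rewrite -natr1 in tN.
have -> : tent t 1 = t - 1 by apply/max_idPr; lra.
have /IH/andP[lo hi] : 0 <= t - 1 <= N%:R by lra.
by apply/andP; split; nra.
Qed.

Lemma tent_sum_sqr_approx N t : 0 <= t <= N%:R ->
  `|tent_sum N t ^+ 2 - t ^+ 4 / 4| <= t ^+ 3 / 2.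
Proof.
move=> tN; have /andP[t0 _] := tN.
have /andP[lo hi] := tent_sum_bounds tN.
have s0 : 0 <= tent_sum N t by apply: sumr_ge0 => x _; apply: tent_ge0.
have t3 : 0 <= t ^+ 3 by rewrite exprn_ge0.
have hi2 : tent_sum N t ^+ 2 <= t ^+ 4 / 4.
  have -> : t ^+ 4 / 4 = (t ^+ 2 / 2) ^+ 2 by field.
  by rewrite lerXn2r ?nnegrE //; nra.
rewrite ler_norml; apply/andP; split; last by lra.
have [t1 | t1] := leP t 1.
  rewrite tent_sum_le1 // expr0n /= sub0r lerN2.
  have -> : t ^+ 4 = t * t ^+ 3 by rewrite -exprS.
  by nra.
have : ((t ^+ 2 - t) / 2) ^+ 2 <= tent_sum N t ^+ 2.
  by rewrite lerXn2r ?nnegrE //; nra.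
have -> : ((t ^+ 2 - t) / 2) ^+ 2 = t ^+ 4 / 4 - t ^+ 3 / 2 + t ^+ 2 / 4 by field.
by have := sqr_ge0 t; lra.
Qed.

Lemma coprime_weight_ge0 N t : 0 <= coprime_weight N t.
Proof. by apply: sumr_ge0 => p _; rewrite mulr_ge0 ?tent_ge0. Qed.

Lemma coprime_weight_le N t : coprime_weight N t <= tent_sum N t ^+ 2.
Proof.
rewrite /tent_sum expr2 big_distrlr /= pair_big /=.
rewrite [leRHS](bigID (fun p : 'I_N.+1 * 'I_N.+1 => coprime p.1 p.2)) /=.
rewrite -[leLHS]addr0 lerD //.
  rewrite le_eqVlt; apply/orP; left; apply/eqP; apply: eq_bigl => -[x y] /=.
  by rewrite /coprime_pos /= andbA.
by apply: sumr_ge0 => p _; rewrite mulr_ge0 ?tent_ge0.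
Qed.

Lemma tent_sum_sqr_decomp N t : t <= N%:R ->
  tent_sum N t ^+ 2 =
  \sum_(1 <= g < N.+1) g%:R ^+ 2 * coprime_weight N (t / g%:R).
Proof.
move=> tN; rewrite /tent_sum sum_by_gcd; last first.
  by move=> m Nm; apply: tent_eq0; apply: le_trans tN _; rewrite ler_nat ltnW.
rewrite big_add1 /= big_mkord big_mkcond big_ord_recl /= add0r.
apply: eq_bigr => g _; rewrite /bump /= add1n mulr_sumr; apply: eq_bigr => p _.
by rewrite -!tent_scale //; ring.
Qed.

(** This is 1 / (4 zeta(2)), with zeta(2) = pi^2 / 6. *)
Definition coprime_density : R := 3 / (2 * pi ^+ 2).

Lemma coprime_density_bounds : 0 < coprime_density <= 1.
Proof.
have p2 : (2 : R) <= pi := pi_ge2 R.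
have p0 : (0 : R) < 2 * pi ^+ 2 by nra.
by rewrite /coprime_density divr_gt0 //= ler_pdivrMr //; nra.
Qed.

Definition coprime_error N t : R := coprime_weight N t - coprime_density * t ^+ 4.

Lemma coprime_error_le N t : 0 <= t <= N%:R -> `|coprime_error N t| <= t ^+ 4.
Proof.
move=> tN; have /andP[lo hi] := tent_sum_bounds tN; have /andP[t0 _] := tN.
have s0 : 0 <= tent_sum N t by apply: sumr_ge0 => x _; apply: tent_ge0.
have hi2 : tent_sum N t ^+ 2 <= t ^+ 4.
  have -> : t ^+ 4 = (t ^+ 2) ^+ 2 by ring.
  by rewrite lerXn2r ?nnegrE //; nra.
have w0 := coprime_weight_ge0 N t; have w1 := coprime_weight_le N t.
have /andP[c0 c1] := coprime_density_bounds.
have t4 : 0 <= t ^+ 4 by rewrite exprn_ge0.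
by rewrite /coprime_error ler_norml; apply/andP; split; nra.
Qed.

(** Subtract the main terms from [tent_sum_sqr_decomp] and solve for the term g = 1. What remains is
    t^3 / 2 from squaring the tent sum, and at most t^3 from cutting the series of zeta(2) at [N],
    whose tail is at most 1 / N <= 1 / t. *)
Lemma coprime_error_rec N t : (0 < N)%N -> 0 <= t <= N%:R ->
  `|coprime_error N t| <= 2 * t ^+ 3 +
     \sum_(2 <= g < N.+1) g%:R ^+ 2 * `|coprime_error N (t / g%:R)|.
Proof.
move=> N0 tN; have /andP[t0 tN'] := tN.
have t3 : 0 <= t ^+ 3 by rewrite exprn_ge0.
have /andP[c0 c1] := coprime_density_bounds.
have /andP[z0 z1] := basel_bounds R N0.
have approx := tent_sum_sqr_approx tN.
set S := \sum_(2 <= g < _) _.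
have E : coprime_error N t = (tent_sum N t ^+ 2 - t ^+ 4 / 4)
    + coprime_density * t ^+ 4 * (pi ^+ 2 / 6 - sum_inv_sqr R N)
    - \sum_(2 <= g < N.+1) g%:R ^+ 2 * coprime_error N (t / g%:R).
  rewrite tent_sum_sqr_decomp //.
  have -> : \sum_(2 <= g < N.+1) g%:R ^+ 2 * coprime_error N (t / g%:R) =
     \sum_(1 <= g < N.+1) g%:R ^+ 2 * coprime_error N (t / g%:R)
       - coprime_error N t.
    by rewrite [in RHS]big_ltn // expr1n mul1r divr1 addrAC subrr add0r.
  have -> : \sum_(1 <= g < N.+1) g%:R ^+ 2 * coprime_error N (t / g%:R) =
    \sum_(1 <= g < N.+1) g%:R ^+ 2 * coprime_weight N (t / g%:R)
      - coprime_density * t ^+ 4 * sum_inv_sqr R N.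
    rewrite /sum_inv_sqr mulr_sumr -sumrB; apply: eq_big_nat => g /andP[g0 _].
    have g1 : g%:R != 0 :> R by rewrite pnatr_eq0 -lt0n.
    rewrite /coprime_error; move: (coprime_weight _ _) coprime_density.
    by move: (g%:R : R) g1 => x x0 w c; field.
  have -> : t ^+ 4 / 4 = coprime_density * t ^+ 4 * (pi ^+ 2 / 6).
    have : (pi : R) != 0 by rewrite lt0r_neq0 ?pi_gt0.
    by rewrite /coprime_density; move: (pi : R) => p p0; field.
  by ring.
have b1 : `|coprime_density * t ^+ 4 * (pi ^+ 2 / 6 - sum_inv_sqr R N)| <= t ^+ 3.
  have d0 : 0 <= pi ^+ 2 / 6 - sum_inv_sqr R N by lra.
  have N0' : (0 : R) < N%:R by rewrite ltr0n.
  have d1 : t * (pi ^+ 2 / 6 - sum_inv_sqr R N) <= 1.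
    apply: (@le_trans _ _ (N%:R * N%:R^-1)).
      by apply: ler_pM => //; lra.
    by rewrite divff ?lt0r_neq0.
  rewrite ger0_norm; last first.
    apply: mulr_ge0 => //; apply: mulr_ge0 (ltW c0) _; exact: exprn_ge0.
  move: (pi ^+ 2 / 6 - sum_inv_sqr R N) d0 d1 => d d0 d1.
  have -> : coprime_density * t ^+ 4 * d =
      t ^+ 3 * (coprime_density * (t * d)) by ring.
  have td : 0 <= t * d by rewrite mulr_ge0.
  by rewrite ler_piMr // mulr_ile1 // ltW.
have b2 : `|\sum_(2 <= g < N.+1) g%:R ^+ 2 * coprime_error N (t / g%:R)| <= S.
  apply: le_trans (ler_norm_sum _ _ _) _; apply: ler_sum => g _.
  by rewrite normrM ger0_norm // exprn_ge0.
rewrite E; apply: le_trans (ler_normB _ _) _.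
apply: lerD => //; apply: le_trans (ler_normD _ _) _; lra.
Qed.

(** The threshold is uniform in [N], because the recursion replaces t by t / g but keeps [N]. *)
Definition eventually_small_error a : Prop :=
  exists T0 : R, 1 <= T0 /\
    forall N t, T0 <= t <= N%:R -> `|coprime_error N t| <= a * t ^+ 4.

(** Telescoping from 2 on: 1/4 + 1/2 = 3/4. *)
Lemma sum_inv_sqr_ge2 N : \sum_(2 <= g < N.+1) (g%:R ^+ 2)^-1 <= 3 / 4 :> R.
Proof.
case: N => [|[|N]]; try by rewrite big_geq // divr_ge0.
have := @sum_inv_sqrD_le R 2 N.+2 isT.
rewrite /sum_inv_sqr big_ltn // [in leRHS]big_ltn // [in leRHS]big_nat1 expr1n.
have : (0 : R) <= N.+2%:R^-1 by rewrite invr_ge0.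
move: N.+2%:R^-1 (\sum_(2 <= _ < _) _) => u v; lra.
Qed.

(* Since [1/4 + 1/9 + 1/16 + ... <= 3/4 < 1], the recursion over the gcd
   contracts the relative error. *)
Lemma eventually_small_error_step a : 0 < a ->
  eventually_small_error a -> eventually_small_error (7 / 8 * a).
Proof.
move=> a0 [T0 [T01 H]].
have ia : 0 < a^-1 by rewrite invr_gt0.
have iaa : a * a^-1 = 1 by rewrite divff ?lt0r_neq0.
(* Chosen so that t / T0 >= 2 + 16 / a, whence G > 1 + 16 / a, and t >= 32 / a, which absorbs the
   term 2 t^3. *)
exists (T0 * (2 + 16 * a^-1) + 32 * a^-1); split; first by nra.
move=> N t /andP[tT tN].
have tT0 : T0 * (2 + 16 * a^-1) <= t by lra.
have t1 : 1 <= t by nra.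
have t0 : 0 < t by lra.
have T00 : 0 < T0 by lra.
(* Up to [G] the argument t / g is still at least [T0] and the hypothesis applies; beyond [G] the
   trivial bound suffices, as the tail of the inverse squares is at most 1 / G. *)
pose G := Num.truncn (t / T0).
have Glo : 1 + 16 * a^-1 < G%:R.
  have : t / T0 < G.+1%:R := truncnS_gt _.
  rewrite -natr1; have : 2 + 16 * a^-1 <= t / T0 by rewrite ler_pdivlMr //; lra.
  by lra.
have Ghi : G%:R <= t / T0 by rewrite /G truncn_le // divr_ge0 // ltW.
have G0 : (0 < G)%N by rewrite -(ltr0n R); lra.
have GN : (G <= N)%N.
  rewrite -(ler_nat R); apply: le_trans Ghi _; apply: le_trans tN.
  by rewrite ler_pdivrMr //; nra.
have N0 : (0 < N)%N by apply: leq_trans GN.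
have t0N : 0 <= t <= N%:R by rewrite tN ltW.
have t4 : 0 <= t ^+ 4 by rewrite exprn_ge0 // ltW.
apply: le_trans (coprime_error_rec N0 t0N) _.
have scale g : (0 < g)%N -> g%:R ^+ 2 * (t / g%:R) ^+ 4 = t ^+ 4 * (g%:R ^+ 2)^-1 :> R.
  move=> g0; have : g%:R != 0 :> R by rewrite pnatr_eq0 -lt0n.
  by move: (g%:R : R) => x x0; field.
have tg g : (0 < g)%N -> 0 <= t / g%:R <= N%:R.
  move=> g0; rewrite divr_ge0 ?(ltW t0) //=; apply: le_trans tN.
  by rewrite ler_pdivrMr ?ltr0n // ler_peMr ?(ltW t0) // ler1n.
have near_part : \sum_(2 <= g < G.+1) g%:R ^+ 2 * `|coprime_error N (t / g%:R)|
    <= 3 / 4 * a * t ^+ 4.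
  apply: (@le_trans _ _ (\sum_(2 <= g < G.+1) a * t ^+ 4 * (g%:R ^+ 2)^-1)).
    apply: ler_sum_nat => g /andP[g2 gG].
    have g0 : (0 < g)%N by apply: leq_ltn_trans g2.
    rewrite -mulrA -scale // mulrCA ler_wpM2l ?exprn_ge0 //.
    apply: H; have /andP[_ ->] := tg g g0; rewrite andbT.
    rewrite ler_pdivlMr ?ltr0n // mulrC -ler_pdivlMr //; apply: le_trans Ghi.
    by rewrite ler_nat.
  rewrite -mulr_sumr mulrC -[leRHS]mulrA ler_wpM2r ?sum_inv_sqr_ge2 //.
  by rewrite mulr_ge0 // ltW.
have far_part : \sum_(G.+1 <= g < N.+1) g%:R ^+ 2 * `|coprime_error N (t / g%:R)|
    <= G%:R^-1 * t ^+ 4.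
  apply: (@le_trans _ _ (\sum_(G.+1 <= g < N.+1) t ^+ 4 * (g%:R ^+ 2)^-1)).
    apply: ler_sum_nat => g /andP[g2 gG].
    have g0 : (0 < g)%N by apply: leq_ltn_trans g2.
    by rewrite -scale // ler_wpM2l ?exprn_ge0 // coprime_error_le // tg.
  rewrite -mulr_sumr mulrC ler_wpM2r //.
  have GNb : (0 < G <= N)%N by rewrite G0.
  have := @sum_inv_sqrD_le R G N GNb.
  rewrite {1}/sum_inv_sqr (@big_cat_nat _ _ _ G.+1) //= -/(sum_inv_sqr R G).
  have : (0 : R) <= N%:R^-1 by rewrite invr_ge0.
  move: (\sum_(G.+1 <= _ < _) _) => u; lra.
rewrite (@big_cat_nat _ _ _ G.+1) //=.
have iG : G%:R^-1 <= a / 16 :> R.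
  rewrite -[leRHS]invrK lef_pV2 ?posrE ?invr_gt0 ?ltr0n ?divr_gt0 //.
  by rewrite invf_div; lra.
have t3 : 2 * t ^+ 3 <= a / 16 * t ^+ 4.
  have -> : t ^+ 4 = t * t ^+ 3 by rewrite -exprS.
  rewrite mulrA ler_wpM2r ?exprn_ge0 ?(ltW t0) //.
  nra.
(* The near part, the far part and the cubic term add up to 3/4 + 1/16 + 1/16 = 7/8. *)
by nra.
Qed.

Lemma eventually_small_error_all a : 0 < a -> eventually_small_error a.
Proof.
move=> a0.
have iter j : eventually_small_error ((7 / 8) ^+ j).
  elim: j => [|j IH].
    (* The trivial bound [coprime_error_le] starts the iteration. *)
    exists 1; split=> // N t tN; rewrite expr0 mul1r coprime_error_le //.
    by lra.
  by rewrite exprS; apply: eventually_small_error_step => //; rewrite exprn_gt0 // divr_gt0.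
have : \forall j \near \oo, (7 / 8 : R) ^+ j < a.
  have lt1 : `|7 / 8 : R| < 1 by rewrite ger0_norm; lra.
  by have /cvgr_lt := cvg_expr lt1; apply.
case=> j _ /(_ j (leqnn j)) /= ja.
have [T0 [T01 H]] := iter j; exists T0; split=> // N t tN.
apply: le_trans (H _ _ tN) _; rewrite ler_wpM2r ?(ltW ja) // exprn_ge0 //.
by lra.
Qed.

End CoprimeWeight.

(** * The upper bound *)

Section MinimumAreaTriples.
Variables (R : realType) (T : finType) (v : T -> R * R).
Hypothesis v_inj : injective v.
Implicit Types (a b c x y z : T) (L : {set T}).

(** Twice the signed area. For fixed distinct [a] and [b] it is an affine function of the third
    point whose level lines are the parallels to the line a b. *)
Definition triple_det a b c : R :=
  ((v b).1 - (v a).1) * ((v c).2 - (v a).2) -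
  ((v c).1 - (v a).1) * ((v b).2 - (v a).2).

Definition min_triple a b c : bool :=
  (triple_det a b c != 0) &&
  [forall x, forall y, forall z, (triple_det x y z != 0) ==>
     (`|triple_det a b c| <= `|triple_det x y z|)].

(** A line is encoded by the set of points of the family that it contains, so that lines form a
    finite type. *)
Definition parallel_through a b c : {set T} :=
  [set x | triple_det a b x == triple_det a b c].

Definition line_through a b : {set T} := [set x | triple_det a b x == 0].

Lemma min_triple_det a b c : min_triple a b c -> triple_det a b c != 0.
Proof. by case/andP. Qed.

Lemma min_tripleP a b c x y z : min_triple a b c -> triple_det x y z != 0 ->
  `|triple_det a b c| <= `|triple_det x y z|.
Proof. by case/andP=> _ /forallP/(_ x)/forallP/(_ y)/forallP/(_ z)/implyP. Qed.

Lemma triple_det_l a b : triple_det a b a = 0.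
Proof. by rewrite /triple_det !subrr mulr0 mul0r subrr. Qed.

Lemma triple_det_r a b : triple_det a b b = 0.
Proof. by rewrite /triple_det mulrC subrr. Qed.

Lemma triple_det_id a c : triple_det a a c = 0.
Proof. by rewrite /triple_det !subrr mulr0 mul0r subrr. Qed.

Lemma min_triple_neq a b c : min_triple a b c -> a != b.
Proof.
by move=> /min_triple_det; apply: contraNneq => ->; rewrite triple_det_id.
Qed.

Lemma neq_coord a b : a != b -> ((v b).1 - (v a).1 != 0) || ((v b).2 - (v a).2 != 0).
Proof.
apply: contraR; rewrite negb_or !negbK !subr_eq0 => /andP[/eqP e1 /eqP e2].
apply/eqP/v_inj/esym; move: e1 e2.
by case: (v a) => ? ?; case: (v b) => ? ? /= -> ->.
Qed.

Lemma triple_det_parallel a b a' b' : a != b ->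
  triple_det a b a' = triple_det a b b' ->
  exists l : R, (v b').1 - (v a').1 = l * ((v b).1 - (v a).1) /\
                (v b').2 - (v a').2 = l * ((v b).2 - (v a).2).
Proof.
move=> ab; rewrite /triple_det => e.
have {}e : ((v b).1 - (v a).1) * ((v b').2 - (v a').2) =
           ((v b').1 - (v a').1) * ((v b).2 - (v a).2).
  move: e; move: (v a) (v b) (v a') (v b') => [? ?] [? ?] [? ?] [? ?] /=; lra.
have /orP[d0|d0] := neq_coord ab.
  exists (((v b').1 - (v a').1) / ((v b).1 - (v a).1)).
  by rewrite divfK //; split=> //; rewrite mulrAC -e mulrC mulKf.
exists (((v b').2 - (v a').2) / ((v b).2 - (v a).2)).
by rewrite divfK //; split=> //; rewrite mulrAC [X in X / _]mulrC e mulfK.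
Qed.

(** The vector from [a'] to [b'] is l times the one from [a] to [b], so heights over the two
    parallel segments agree up to the factor l and a shift. This moves comparisons of area from one
    line to a parallel one. *)
Lemma triple_det_scale a b a' b' : a != b ->
  triple_det a b a' = triple_det a b b' ->
  exists l : R, (a' != b' -> l != 0) /\ forall x,
    triple_det a' b' x = l * (triple_det a b x - triple_det a b a').
Proof.
move=> ab /(triple_det_parallel ab)[l [e1 e2]]; exists l; split=> [|x].
  by move=> /neq_coord; apply: contraTneq => l0; rewrite e1 e2 l0 !mul0r eqxx.
by rewrite /triple_det e1 e2; ring.
Qed.

(* [s] is an affine coordinate along the line [L], on which [c] is seen at
   signed height [h c]. *)
Definition line_coord L (s h : T -> R) : Prop :=
  forall x y c, x \in L -> y \in L -> triple_det x y c = (s y - s x) * h c.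

Lemma line_coord_exists a b : a != b ->
  exists s, line_coord (line_through a b) s (triple_det a b).
Proof.
move=> ab.
have [s sP] : exists s : T -> R, forall x, x \in line_through a b ->
    (v x).1 - (v a).1 = s x * ((v b).1 - (v a).1) /\
    (v x).2 - (v a).2 = s x * ((v b).2 - (v a).2).
  suff /choice[s sP] : forall x, exists l : R, x \in line_through a b ->
      (v x).1 - (v a).1 = l * ((v b).1 - (v a).1) /\
      (v x).2 - (v a).2 = l * ((v b).2 - (v a).2) by exists s.
  move=> x.
  (* Off the line the coordinate is arbitrary and is set to 0. *)
  have [|_] := boolP (x \in line_through a b); last by exists 0.
  rewrite inE => /eqP e.
  have [|l lP] := @triple_det_parallel a b a x ab; last by exists l.
  by rewrite e triple_det_l.
exists s => x y c /sP[x1 x2] /sP[y1 y2]; rewrite /triple_det.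
move: x1 x2 y1 y2; case: (v x) (v y) (v c) (v a) (v b).
move=> x1 x2 [y1 y2] [c1 c2] [a1 a2] [b1 b2] /= e1 e2 e3 e4.
have -> : x1 = a1 + s x * (b1 - a1) by rewrite -e1; ring.
have -> : x2 = a2 + s x * (b2 - a2) by rewrite -e2; ring.
have -> : y1 = a1 + s y * (b1 - a1) by rewrite -e3; ring.
have -> : y2 = a2 + s y * (b2 - a2) by rewrite -e4; ring.
by ring.
Qed.

Definition min_bases L : {set T * T} :=
  [set p | (p.1 \in L) && (p.2 \in L) && [exists c, min_triple p.1 p.2 c]].

(* The two ends of a base are consecutive along the line, hence a base is
   determined by its lower end, which is not the topmost point of the line. *)
Lemma card_min_bases_half L s h : line_coord L s h ->
  (#|[set p in min_bases L | (s p.1 < s p.2)%R]| <= #|L|.-1)%N.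
Proof.
move=> sh; case: (pickP (mem L)) => [z0 z0L | L0]; last first.
  rewrite (eq_card0 (A := [set p in _ | _])) // => p; rewrite !inE.
  by have /= -> := L0 p.1.
have [z zL zmax] := @arg_maxP _ R T z0 (mem L) s z0L.
have {}zL : z \in L by [].
rewrite (cardsD1 z L) zL /=.
rewrite -(@card_in_imset _ _ fst); last first.
  (* If [y'] lay strictly below [y], the base x y' with the same apex would give a smaller nonzero
     area. *)
  have key x y y' : (x, y) \in min_bases L -> (x, y') \in min_bases L ->
      s x < s y -> s x < s y' -> s y <= s y'.
    rewrite !inE /= => /andP[/andP[xL yL] /existsP[c mc]].
    move=> /andP[/andP[_ yL'] _] xy xy'.
    have := @min_tripleP _ _ _ x y' c mc; rewrite !sh //.
    have := min_triple_det mc; rewrite sh // mulf_eq0 negb_or => /andP[_ hc].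
    rewrite mulf_neq0 // ?subr_eq0 ?gt_eqF // => /(_ isT).
    rewrite !normrM ler_pM2r ?normr_gt0 // !gtr0_norm ?subr_gt0 //.
    by rewrite lerD2r.
  move=> [x y] [x' y']; rewrite ![_ \in [set _ in _ | _]]inE /=.
  move=> /andP[xy sxy] /andP[xy' sxy'] xx'; rewrite -{}xx' in xy' sxy' *.
  have e : s y = s y' by apply/le_anti; rewrite (key x y y') ?(key x y' y).
  (* Two distinct points with equal coordinate would make every determinant based on the line
     vanish. *)
  congr (_, _); apply/eqP/negPn/negP => yy'.
  move: xy xy'; rewrite !inE /=.
  move=> /andP[/andP[xL yL] /existsP[c mc]] /andP[/andP[_ yL'] _].
  have d0 w : triple_det y y' w = 0 by rewrite sh // e subrr mul0r.
  have [|l [_ lP]] := @triple_det_scale y y' x y yy'; first by rewrite !d0.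
  by have := min_triple_det mc; rewrite lP !d0 subr0 mulr0 eqxx.
apply/subset_leq_card/fintype.subsetP => x /imsetP[[x' y]]; rewrite !inE /=.
move=> /andP[/andP[/andP[xL yL] _] sxy] ->; rewrite xL andbT.
by apply: contraTneq sxy => ->; rewrite -leNgt; apply: zmax.
Qed.

(** An ordered base points up or down the line; negating the coordinate exchanges the two cases. *)
Lemma card_min_bases a b : a != b ->
  (#|min_bases (line_through a b)| <= 2 * #|line_through a b|.-1)%N.
Proof.
move=> ab; have [s sP] := line_coord_exists ab.
set L := line_through a b in sP *.
have sN : line_coord L (fun x => - s x) (fun c => - triple_det a b c).
  by move=> x y c xL yL; rewrite sP //; ring.
have h1 := card_min_bases_half sP; have h2 := card_min_bases_half sN.
rewrite mul2n -addnn; apply: leq_trans (leq_add h1 h2).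
apply: leq_trans (leq_card_setU _ _); apply/subset_leq_card/fintype.subsetP => -[x y] xy.
rewrite finset.in_setU ![_ \in [set _ in _ | _]]inE xy /= ltrN2.
have [//|//|sxy] := ltgtP (s x) (s y).
move: xy; rewrite inE /= => /andP[/andP[xL yL] /existsP[c /min_triple_det]].
by rewrite sP // sxy subrr mul0r eqxx.
Qed.

Definition min_triples : {set T * T * T} := [set p | min_triple p.1.1 p.1.2 p.2].

Definition min_triples_on L L' : {set T * T * T} :=
  [set p in min_triples | (line_through p.1.1 p.1.2 == L) &&
                          (parallel_through p.1.1 p.1.2 p.2 == L')].

Lemma card_min_triples_on L L' :
  (#|min_triples_on L L'| <= 2 * #|L|.-1 * #|L'|)%N.
Proof.
have [->|[p0]] := finset.set_0Vmem (min_triples_on L L'); first by rewrite finset.cards0.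
rewrite !inE => /andP[m0 /andP[/eqP eL _]].
have := card_min_bases (min_triple_neq m0); rewrite eL => hb.
apply: leq_trans (leq_mul hb (leqnn _)).
rewrite -cardsX; apply/subset_leq_card/fintype.subsetP => -[[a b] c].
rewrite !inE /= => /andP[m /andP[/eqP <- /eqP <-]].
rewrite !inE triple_det_l triple_det_r !eqxx /= andbT.
by apply/existsP; exists c.
Qed.

(** Adjacency is witnessed by a minimum triple between the two lines; the absence of points strictly
    between them is then a consequence. *)
Definition adjacent_lines L L' : bool :=
  (min_triples_on L L' != finset.set0) || (min_triples_on L' L != finset.set0).

Lemma adjacent_linesC L L' : adjacent_lines L L' = adjacent_lines L' L.
Proof. by rewrite /adjacent_lines orbC. Qed.

(** A point strictly between the lines would form, with the base of the witnessing triple, a smaller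
    triangle of positive area. *)
Lemma adjacent_linesP L L' a b : adjacent_lines L L' ->
  a \in L -> b \in L -> a != b ->
  [/\ L = line_through a b &
     exists z, [/\ triple_det a b z != 0, L' = parallel_through a b z &
       forall x, ~~ ((0 < triple_det a b x < triple_det a b z) ||
                     (triple_det a b z < triple_det a b x < 0))]].
Proof.
move=> /orP[] /finset.set0Pn[[[a' b'] c]]; rewrite !inE /=.
  move=> /andP[m /andP[/eqP <- /eqP <-]]; rewrite !inE => /eqP ea /eqP eb ab.
  have ab' := min_triple_neq m.
  have [|l [/(_ ab) l0 lP]] := @triple_det_scale a' b' a b ab'; first by rewrite ea eb.
  have {}lP x : triple_det a b x = l * triple_det a' b' x.
    by rewrite lP ea subr0.
  split; first by apply/finset.setP => x; rewrite !inE lP mulf_eq0 (negbTE l0).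
  exists c; split.
  - by rewrite lP mulf_neq0 // (min_triple_det m).
  - by apply/finset.setP => x; rewrite !inE !lP (inj_eq (mulfI l0)).
  move=> x; apply/negP => bt.
  have x0 : triple_det a b x != 0 by apply: contraTneq bt => ->; lra.
  have : triple_det a' b' x != 0 by move: x0; rewrite lP mulf_eq0 negb_or => /andP[].
  move=> /(min_tripleP m); have l1 : 0 < `|l| by rewrite normr_gt0.
  rewrite -(ler_pM2l l1) -!normrM -!lP.
  by move: bt => /orP[] /andP[h1 h2]; [rewrite !gtr0_norm|rewrite !ltr0_norm]; lra.
(* Here the base [a'] [b'] lies on [L'], and its end [a'] serves as the point of that line seen from
   [a] and [b]. *)
move=> /andP[m /andP[/eqP <- /eqP <-]]; rewrite !inE => /eqP ea /eqP eb ab.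
have ab' := min_triple_neq m; have c0 := min_triple_det m.
have [|l [/(_ ab) l0 lP]] := @triple_det_scale a' b' a b ab'; first by rewrite ea eb.
rewrite ea in lP; split.
  by apply/finset.setP => x; rewrite !inE lP mulf_eq0 (negbTE l0) subr_eq0.
exists a'; split.
- by rewrite lP triple_det_l sub0r mulf_neq0 // oppr_eq0.
- apply/finset.setP => x; rewrite !inE !lP (inj_eq (mulfI l0)) triple_det_l.
  by rewrite (inj_eq (addIr _)).
move=> x; apply/negP => bt.
have x0 : triple_det a' b' x != 0.
  by apply: contraTneq bt => x0; rewrite !lP x0 triple_det_l; lra.
have l1 : 0 < `|l| by rewrite normr_gt0.
have := min_tripleP m x0; rewrite -(ler_pM2l l1) -!normrM.
have -> : l * triple_det a' b' c = - triple_det a b a'.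
  by rewrite lP triple_det_l; ring.
have -> : l * triple_det a' b' x = triple_det a b x - triple_det a b a'.
  by rewrite !lP triple_det_l; ring.
rewrite normrN; move: bt {lP}.
move: (triple_det a b a') (triple_det a b x) => p q /orP[] pq.
  by rewrite (gtr0_norm (x := p)) ?(ltr0_norm (x := q - p)); lra.
by rewrite (ltr0_norm (x := p)) ?(gtr0_norm (x := q - p)); lra.
Qed.

(** A neighbour is determined by its side of [L]: of two on the same side, the nearer would lie
    strictly between [L] and the other. *)
Lemma card_adjacent_lines L : (1 < #|L|)%N ->
  (#|adjacent_lines L| <= 2)%N.
Proof.
case/card_gt1P => a [b [aL bL ab]].
rewrite -card_bool -(@card_in_imset _ _ (fun L' : {set T} =>
   [exists x in L', 0 < triple_det a b x])) ?max_card //.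
move=> L1 L2.
move=> /adjacent_linesP/(_ aL bL ab)[_ [z1 [n1 -> h1]]].
move=> /adjacent_linesP/(_ aL bL ab)[_ [z2 [n2 -> h2]]].
have posE z : [exists x in parallel_through a b z, 0 < triple_det a b x] =
              (0 < triple_det a b z).
  apply/existsP/idP => [[x]|z0]; last by exists z; rewrite inE eqxx.
  by rewrite inE => /andP[/eqP ->].
rewrite !posE => e.
suff : triple_det a b z1 = triple_det a b z2 by rewrite /parallel_through => ->.
have := h1 z2; have := h2 z1; move: n1 n2 e.
move: (triple_det a b z1) (triple_det a b z2) => p q.
by case: (ltgtP 0 p) => // p0; case: (ltgtP 0 q) => // q0; case: (ltgtP p q).
Qed.

(** The double counting of the overview for ordered triples: each triangle occurs six times instead
    of three, which doubles the constant. *)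
Lemma card_min_triples : (#|min_triples| <= 4 * (#|T| * #|T|.-1))%N.
Proof.
pose f L L' := #|min_triples_on L L'|.
pose w L := (#|L| * #|L|.-1)%N.
have partF : #|min_triples| = (\sum_(L : {set T}) \sum_(L' : {set T}) f L L')%N.
  rewrite -sum1_card pair_big /=.
  rewrite (partition_big (fun p : T * T * T => (line_through p.1.1 p.1.2,
     parallel_through p.1.1 p.1.2 p.2)) predT) //=.
  apply: eq_bigr => -[L L'] _; rewrite /f -sum1_card; apply: eq_bigl => p.
  by rewrite [in RHS]inE xpair_eqE.
(* With k and m points, 2(k-1)m + 2(m-1)k <= 2(k(k-1) + m(m-1)) because 2km <= k^2 + m^2. *)
have fle L L' : (f L L' + f L' L <=
    if adjacent_lines L L' then 2 * (w L + w L') else 0)%N.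
  case: ifP => [_|]; last first.
    by move/negbT; rewrite negb_or !negbK /f => /andP[/eqP -> /eqP ->]; rewrite finset.cards0.
  apply: leq_trans (leq_add (card_min_triples_on _ _) (card_min_triples_on _ _)) _.
  rewrite /w; case: (#|L|) => [|k]; case: (#|L'|) => [|m] //=; try by nia.
  have := (nat_Cauchy k m).1; rewrite -!mulnn; nia.
(* Summing over both orders of a pair of lines counts every triple twice. *)
have dbl : (2 * #|min_triples| <= 4 * \sum_(L : {set T})
     \sum_(L' : {set T} | adjacent_lines L L') w L)%N.
  rewrite mul2n -addnn {1}partF partF [X in (_ + X)%N]exchange_big /=.
  rewrite -big_split /=; under eq_bigr do rewrite -big_split /=.
  have -> : (4 * \sum_(L : {set T}) \sum_(L' : {set T} | adjacent_lines L L') w L =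
    \sum_(L : {set T}) \sum_(L' : {set T} | adjacent_lines L L') 2 * (w L + w L'))%N.
    under [in RHS]eq_bigr do rewrite -big_distrr big_split /=.
    rewrite -big_distrr big_split /=.
    have -> : (\sum_(L : {set T}) \sum_(L' : {set T} | adjacent_lines L L') w L' =
       \sum_(L : {set T}) \sum_(L' : {set T} | adjacent_lines L L') w L)%N.
      rewrite [LHS](exchange_big_dep predT) //=; apply: eq_bigr => L _.
      by apply: eq_bigl => L'; rewrite adjacent_linesC.
    by rewrite addnn -mul2n mulnA.
  apply: leq_sum => L _; rewrite [leqRHS]big_mkcond /=.
  by apply: leq_sum => L' _; apply: fle.
pose has_adj L := [exists L', adjacent_lines L L'].
have deg : (\sum_(L : {set T}) \sum_(L' : {set T} | adjacent_lines L L') w L <=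
     2 * \sum_(L : {set T} | has_adj L) w L)%N.
  rewrite big_distrr /= [leqRHS]big_mkcond /=; apply: leq_sum => L _.
  rewrite sum_nat_const; case: ifP => [_|/negbT]; last first.
    rewrite negb_exists => /forallP nadj; rewrite eq_card0 // => L'.
    by apply/negbTE; exact: nadj.
  (* A line with at most one point may have many neighbours, but its weight [w] is 0. *)
  case: (leqP #|L| 1) => L1.
    by rewrite /w; case: (#|L|) L1 => [|[|]] //; rewrite !muln0.
  rewrite leq_mul2r; apply/orP; right.
  exact: card_adjacent_lines.
(* [w L] is the number of ordered pairs of distinct points on [L], and such a pair determines any
   line with a neighbour that contains it. *)
have wle : (\sum_(L : {set T} | has_adj L) w L <= #|T| * #|T|.-1)%N.
  have wE (A : {set T}) : (#|A| * #|A|.-1 =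
      \sum_(p : T * T | p.1 != p.2) ((p.1 \in A) && (p.2 \in A)))%N.
    rewrite -(pair_big_dep xpredT (fun a b => a != b)
       (fun a b => ((a \in A) && (b \in A) : nat))) /=.
    rewrite -sum_nat_const big_mkcond; apply: eq_bigr => a _.
    case: ifP => aA; last by rewrite big1.
    rewrite /= (cardsD1 a A) aA /= -sum1_card big_mkcond [RHS]big_mkcond /=.
    by apply: eq_bigr => b _; rewrite !inE eq_sym; case: (a != b); case: (b \in A).
  rewrite -cardsT wE; under eq_bigr do rewrite /w wE.
  rewrite exchange_big /=; apply: leq_sum => -[a b] /= ab; rewrite !finset.in_setT /=.
  rewrite -big_mkcondr /= sum1_card.
  apply: leq_trans (_ : #|pred1 (line_through a b)| <= _)%N; last by rewrite card1.
  apply/subset_leq_card/fintype.subsetP => L.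
  move=> /andP[/existsP[L' adj] /andP[aL bL]].
  by rewrite inE; have [-> _] := adjacent_linesP adj aL bL ab.
by move: dbl deg wle; lia.
Qed.

End MinimumAreaTriples.

(** * Triangles as three-element sets versus ordered triples *)

Section TrianglesAsSets.
Variable R : realType.
Implicit Types (S T : {fset R * R}) (p q r : R * R).

Lemma area_swap12 p q r : area q p r = area p q r.
Proof. by rewrite /area -normrN; congr (`|_| / 2); ring. Qed.

Lemma area_swap23 p q r : area p r q = area p q r.
Proof. by rewrite /area -normrN; congr (`|_| / 2); ring. Qed.

Lemma area_perm p q r :
  [/\ area q p r = area p q r, area p r q = area p q r, area r p q = area p q r,
      area q r p = area p q r & area r q p = area p q r].
Proof.
split; [exact: area_swap12 | exact: area_swap23 | | | ].
- by rewrite [LHS]area_swap12 [LHS]area_swap23.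
- by rewrite [LHS]area_swap23 [LHS]area_swap12.
- by rewrite [LHS]area_swap12 [LHS]area_swap23 [LHS]area_swap12.
Qed.

Lemma area_gt0_uniq p q r : 0 < area p q r -> uniq [:: p; q; r].
Proof.
rewrite /= !inE negb_or andbT -andbA => a0; apply/and3P; split;
  apply: contraTneq a0 => ->; rewrite /area.
- by rewrite !subrr mul0r mulr0 subrr normr0 mul0r ltxx.
- by rewrite !subrr mul0r mulr0 subrr normr0 mul0r ltxx.
- by rewrite subrr normr0 mul0r ltxx.
Qed.

Lemma enum_fset3 (T : {fset R * R}) : #|` T| = 3%N ->
  exists p q r, [/\ enum_fset T = [:: p; q; r], uniq [:: p; q; r],
                    T = [fset p; q; r] & triangle_area T = area p q r].
Proof.
move=> T3; case E : (enum_fset T) => [|p [|q [|r [|]]]];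
  try by move: T3; rewrite E.
exists p, q, r; split => //.
- by rewrite -E fset_uniq.
- by apply/fsetP => x; rewrite !inE -[x \in T]/(x \in enum_fset T) E !inE orbA.
- by rewrite /triangle_area E.
Qed.

(** The enumeration of the set is some permutation of [p], [q], [r], under which [area] is
    invariant. *)
Lemma triangle_area_fset3 p q r : uniq [:: p; q; r] ->
  #|` [fset p; q; r]| = 3%N /\ triangle_area [fset p; q; r] = area p q r.
Proof.
move=> u; have c3 : #|` [fset p; q; r]| = 3%N.
  have /perm_size -> // : perm_eq (enum_fset [fset p; q; r]) [:: p; q; r].
  by apply: uniq_perm => // x; rewrite -[LHS]/(x \in [fset p; q; r]) !inE orbA.
split=> //; have [a [b [c [E u' eT ->]]]] := enum_fset3 c3.
have mem x : (x \in [:: a; b; c]) = (x \in [:: p; q; r]).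
  by rewrite -E -[LHS]/(x \in [fset p; q; r]) !inE orbA.
have : p \in [:: a; b; c] by rewrite mem !inE eqxx.
have : q \in [:: a; b; c] by rewrite mem !inE eqxx orbT.
have : r \in [:: a; b; c] by rewrite mem !inE eqxx !orbT.
move: u; rewrite /= !inE negb_or andbT => /andP[/andP[pq pr] qr].
have [h1 h2 h3 h4 h5] := area_perm a b c.
by move=> /or3P[]/eqP ? /or3P[]/eqP ? /or3P[]/eqP ?; subst;
  rewrite ?eqxx // in pq pr qr *;
  rewrite ?h1 ?h2 ?h3 ?h4 ?h5.
Qed.

Lemma nondeg_triangles_fset3 S p q r : p \in S -> q \in S -> r \in S ->
  0 < area p q r -> [fset p; q; r] \in nondeg_triangles S.
Proof.
move=> pS qS rS a0; have [c3 e] := triangle_area_fset3 (area_gt0_uniq a0).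
rewrite !inE /= c3 eqxx e a0 !andbT fpowersetE.
by apply/fsubsetP => x; rewrite !inE => /orP[/orP[]|] /eqP ->.
Qed.

Lemma min_area_trianglesP S T :
  reflect (exists p q r, [/\ T = [fset p; q; r], [/\ p \in S, q \in S & r \in S],
             0 < area p q r & forall x y z, x \in S -> y \in S -> z \in S ->
             0 < area x y z -> area p q r <= area x y z])
          (T \in min_area_triangles S).
Proof.
apply: (iffP idP).
  rewrite !inE /= fpowersetE => /andP[/andP[/fsubsetP TS /andP[/eqP c3 a0]] /forallP mn].
  have [p [q [r [E _ eT aT]]]] := enum_fset3 c3.
  exists p, q, r; split => //; last 1 first.
  - move=> x y z xS yS zS xyz0.
    have nd := nondeg_triangles_fset3 xS yS zS xyz0.
    have := mn [` nd]; rewrite /= aT.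
    by have [_ ->] := triangle_area_fset3 (area_gt0_uniq xyz0).
  - by split; apply: TS; rewrite eT !inE eqxx ?orbT.
  - by rewrite -aT.
case=> p [q [r [-> [pS qS rS] a0 mn]]].
rewrite in_fset /= inE /= nondeg_triangles_fset3 //=.
have [_ ->] := triangle_area_fset3 (area_gt0_uniq a0).
apply/forallP => -[T' /=]; rewrite !inE /= fpowersetE.
move=> /andP[/fsubsetP TS /andP[/eqP c3]].
have [x [y [z [E _ eT ->]]]] := enum_fset3 c3.
by apply: mn; apply: TS; rewrite eT !inE eqxx ?orbT.
Qed.

(** Double counting of pairs of a triangle and an ordering of its vertices: six orderings per
    triangle, and at most one triangle per ordered triple. *)
Lemma card_min_area_triangles S :
  (6 * #|` min_area_triangles S| <= #|min_triples (fun x : S => fsval x)|)%N.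
Proof.
set M := min_area_triangles S; set F := min_triples _.
pose g (p : S * S * S) := [fset fsval p.1.1; fsval p.1.2; fsval p.2].
have six (T : M) : (6 <= \sum_(p in F) (g p == fsval T))%N.
  have /min_area_trianglesP[p [q [r [eT [pS qS rS] a0 mn]]]] := fsvalP T.
  pose a := [` pS]; pose b := [` qS]; pose c := [` rS].
  pose s := [:: (a, b, c); (b, a, c); (a, c, b); (c, a, b); (b, c, a); (c, b, a)].
  have us : uniq s.
    have := area_gt0_uniq a0; rewrite /= !inE negb_or andbT => /andP[/andP[pq pr] qr].
    have ab : a != b by []. have ac : a != c by []. have bc : b != c by [].
    rewrite /s /= !xpair_eqE !eqxx /= ![b == a]eq_sym ![c == a]eq_sym ![c == b]eq_sym.
    by rewrite (negbTE ab) (negbTE ac) (negbTE bc).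
  have sub x : x \in s -> (x \in F) && (g x == fsval T).
    have ok (x' y' z' : S) : area (fsval x') (fsval y') (fsval z') = area p q r ->
        (x', y', z') \in F.
      move=> e; rewrite inE /=; apply/andP; split.
        by apply: contraTneq a0 => d0; rewrite -e /area -/(triple_det _ _ _ _) d0 normr0 mul0r ltxx.
      apply/forallP => x1; apply/forallP => y1; apply/forallP => z1; apply/implyP => d1.
      rewrite -(@ler_pM2r _ 2^-1) // -[leLHS]/(area (fsval x') (fsval y') (fsval z')) e.
      apply: mn; rewrite ?fsvalP // /area divr_gt0 // normr_gt0 //.
    have [e1 e2 e3 e4 e5] := area_perm p q r.
    rewrite /s !in_cons in_nil orbF => /or4P[||| /or3P[]] /eqP ->;
      (apply/andP; split; [exact: ok | rewrite eT /g /=]);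
      by apply/eqP/fsetP => w; rewrite !inE /=;
         case: (w == p); case: (w == q); case: (w == r).
  rewrite -big_mkcondr sum1_card cardE -[6%N]/(size s).
  by apply: uniq_leq_size us _ => x /sub; rewrite mem_enum.
rewrite cardfE mulnC -sum_nat_const.
apply: (@leq_trans (\sum_(T : M) \sum_(p in F) (g p == fsval T))).
  by apply: leq_sum => T _; apply: six.
rewrite exchange_big /= -sum1_card; apply: leq_sum => p _.
rewrite -big_mkcond sum1_card.
apply/card_le1_eqP => T1 T2; rewrite !unfold_in => /eqP e1 /eqP e2.
by do 2!apply: val_inj; apply: etrans (esym e2) e1.
Qed.

Lemma card_min_area_triangles_le S :
  (3 * #|` min_area_triangles S| <= 2 * (#|` S| * #|` S|.-1))%N.
Proof.
have := leq_trans (card_min_area_triangles S) (card_min_triples val_inj).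
rewrite -cardfE; lia.
Qed.

End TrianglesAsSets.

(** * The grid *)

Section Grid.
Variable R : realType.

Definition nat_point (p : nat * nat) : R * R := (p.1%:R, p.2%:R).

Lemma nat_point_inj : injective nat_point.
Proof. by move=> [a b] [c d] [] /eqP + /eqP; rewrite !eqr_nat => /eqP -> /eqP ->. Qed.

Definition grid_side n : nat := Num.truncn (Num.sqrt (n%:R : R)).

Lemma mem_grid n (p : R * R) : reflect
  (exists2 q : nat * nat, p = nat_point q &
     (0 < q.1 <= grid_side n)%N && (0 < q.2 <= grid_side n)%N)
  (p \in grid R n).
Proof.
apply: (iffP idP) => [/imfset2P/= [i ik [j jk ->]] | [[i j] -> /= /andP[ik jk]]].
  by exists (i, j) => //=; move: ik jk; rewrite !mem_iota !add1n !ltnS => -> ->.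
apply/imfset2P; exists i; first by rewrite mem_iota add1n ltnS.
by exists j; rewrite // mem_iota add1n ltnS.
Qed.

Lemma grid_side_sqr_le n : (grid_side n * grid_side n <= n)%N.
Proof.
rewrite -(ler_nat R) natrM -expr2 -[leRHS]sqr_sqrtr ?ler0n //.
rewrite lerXn2r ?nnegrE ?ler0n ?sqrtr_ge0 //.
by rewrite truncn_le // sqrtr_ge0.
Qed.

Lemma grid_side_sqrS_ge n : n%:R <= (grid_side n).+1%:R ^+ 2 :> R.
Proof.
rewrite -[leLHS]sqr_sqrtr ?ler0n // lerXn2r ?nnegrE ?sqrtr_ge0 ?ler0n //.
exact: ltW (truncnS_gt _).
Qed.

Lemma card_grid_le n : (#|` grid R n| <= n)%N.
Proof.
apply: leq_trans (grid_side_sqr_le n); rewrite /grid.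
rewrite (perm_size (enum_imfset2 _ _)) /=; last first.
  by move=> [i j] [i' j'] _ _ /= [] /eqP + /eqP; rewrite !eqr_nat => /eqP -> /eqP ->.
by rewrite size_allpairs !undup_id ?iota_uniq // !size_iota.
Qed.

(** Twice the area of a lattice triangle is an integer. *)
Lemma nat_point_area_ge (p q r : nat * nat) :
  0 < area (nat_point p) (nat_point q) (nat_point r) ->
  1 / 2 <= area (nat_point p) (nat_point q) (nat_point r).
Proof.
rewrite /area; set d := _ - _ => d0.
have dint : d \is a Num.int by rewrite /d !(rpredB, rpredM, natr_int).
rewrite ler_pM2r ?invr_gt0 // norm_intr_ge1 //.
by move: d0; rewrite pmulr_lgt0 ?invr_gt0 // normr_gt0.
Qed.

Lemma half_area_triangle_min n (p q r : nat * nat) :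
  nat_point p \in grid R n -> nat_point q \in grid R n ->
  nat_point r \in grid R n ->
  area (nat_point p) (nat_point q) (nat_point r) = 1 / 2 ->
  [fset nat_point p; nat_point q; nat_point r] \in min_area_triangles (grid R n).
Proof.
move=> pG qG rG e; apply/min_area_trianglesP.
exists (nat_point p), (nat_point q), (nat_point r); split => //; rewrite e ?divr_gt0 //.
by move=> x y z /mem_grid[x' -> _] /mem_grid[y' -> _] /mem_grid[z' -> _] /nat_point_area_ge.
Qed.

(* [a] and [b] are opposite corners of the bounding box of [a], [b], [c]. *)
Definition box_triple (a b c : nat * nat) : Prop :=
  [/\ a.1 < b.1, a.1 <= c.1 <= b.1,
      (a.2 < b.2) && (a.2 <= c.2 <= b.2) || (b.2 < a.2) && (b.2 <= c.2 <= a.2),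
      (c.1 != a.1) || (c.2 != a.2) & (c.1 != b.1) || (c.2 != b.2)]%N.

(** Only [a] and [b] can be opposite corners of the bounding box, and [a] is the left one; every
    other assignment of vertices is contradictory. *)
Lemma box_triple_unique a b c a' b' c' : box_triple a b c -> box_triple a' b' c' ->
  a' \in [:: a; b; c] -> b' \in [:: a; b; c] -> c' \in [:: a; b; c] ->
  [/\ a' = a, b' = b & c' = c].
Proof.
case: a b c => [a1 a2] [b1 b2] [c1 c2] [/= h1 h2 h3 h4 h5].
move=> bx; rewrite !inE.
move=> /or3P[]/eqP ea /or3P[]/eqP eb /or3P[]/eqP ec; move: bx; rewrite ea eb ec;
  case=> /= k1 k2 k3 k4 k5; first [by split | exfalso; lia].
Qed.

(* For coprime positive [x], [y] the pair [(s, u)] with [x u = y s + 1] and its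
   reflection [(x - s, y - u)] are the two lattice points of the box
   [0, x] x [0, y] spanning area 1/2 with the diagonal. *)
Definition box_apex (x y : nat) (sigma : bool) : nat * nat :=
  let: (u, s) := egcdn x y in if sigma then (s, u) else (x - s, y - u)%N.

(** [egcdn] yields the Bezout relation with s < x, which forces u <= y; reflecting in the centre of
    the box changes the sign. *)
Lemma box_apexP x y sigma : coprime_pos (x, y) ->
  let: (s, u) := box_apex x y sigma in
  [/\ (s <= x)%N, (u <= y)%N &
      if sigma then (x * u = y * s + 1)%N else (x * u + 1 = y * s)%N].
Proof.
rewrite /coprime_pos /box_apex /= => /and3P[x0 y0 /eqP cxy].
case: egcdnP => // u s; rewrite cxy muln1 => e sx.
have uy : (u <= y)%N by nia.
by case: sigma; split; nia.
Qed.

Lemma box_apex_neq x y : coprime_pos (x, y) -> box_apex x y true <> box_apex x y false.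
Proof.
move=> cxy; have := @box_apexP x y true cxy; have := @box_apexP x y false cxy.
case: (box_apex _ _ true) => s u; case: (box_apex _ _ false) => s' u'.
by move=> [_ _ h1] [_ _ h2] [e1 e2]; subst; nia.
Qed.

(** * Counting triangles of area 1/2 inscribed in lattice boxes *)

Section BoxTriangles.
Variable k : nat.

(* The index [((x, y), (i, j), (rho, sigma))] stands for the box of size
   [x * y] with lower left corner [(i + 1, j + 1)], one of its diagonals [rho]
   and the side [sigma] of that diagonal. *)
Definition box_index : finType :=
  (('I_k.+1 * 'I_k.+1) * ('I_k * 'I_k) * (bool * bool))%type.

Definition box_ok (t : box_index) : bool :=
  [&& coprime_pos (t.1.1.1 : nat, t.1.1.2 : nat), (t.1.2.1 + t.1.1.1 < k)%N &
      (t.1.2.2 + t.1.1.2 < k)%N].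

(** Reflecting the box top to bottom exchanges its rising and falling diagonals; the successors are
    there because the grid starts at 1. *)
Definition box_point (t : box_index) (p : nat * nat) : nat * nat :=
  ((t.1.2.1 + p.1).+1,
   (t.1.2.2 + if t.2.1 then (t.1.1.2 - p.2)%N else p.2).+1).

Definition box_a t := box_point t (0%N, 0%N).
Definition box_b (t : box_index) := box_point t (t.1.1.1 : nat, t.1.1.2 : nat).
Definition box_c (t : box_index) := box_point t (box_apex t.1.1.1 t.1.1.2 t.2.2).

Definition box_triangle t : {fset R * R} :=
  [fset nat_point (box_a t); nat_point (box_b t); nat_point (box_c t)].

Lemma box_triangle_triple t : box_ok t -> box_triple (box_a t) (box_b t) (box_c t).
Proof.
case: t => [[[x y] [i j]] [rho sigma]] /and3P[/= cxy ix jy].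
rewrite /box_a /box_b /box_c /box_point /=; have := @box_apexP x y sigma cxy.
case/and3P: cxy => /= x0 y0 _.
case: (box_apex x y sigma) => s u [sx uy h].
by case: rho; case: sigma h => h; split => /=; nia.
Qed.

(** The vertices [a] and [b], recovered by [box_triple_unique], fix the box and its diagonal; the
    third vertex then fixes the side, the two apexes being distinct. *)
Lemma box_triangle_inj : {in box_ok &, injective box_triangle}.
Proof.
move=> t t' okt okt' e.
have mem p : (p \in [:: box_a t'; box_b t'; box_c t']) =
             (p \in [:: box_a t; box_b t; box_c t]).
  have /fsetP/(_ (nat_point p)) := e.
  by rewrite !inE !(inj_eq nat_point_inj) -!orbA.
have [ea eb ec] : [/\ box_a t' = box_a t, box_b t' = box_b t & box_c t' = box_c t].
  apply: box_triple_unique (box_triangle_triple okt) (box_triangle_triple okt') _ _ _;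
  by rewrite -mem !inE eqxx ?orbT.
move: okt okt' ea eb ec {e mem}.
case: t t' => [[[x y] [i j]] [rho sigma]] [[[x' y'] [i' j']] [rho' sigma']].
move=> /and3P[/= cxy ix jy] /and3P[/= cxy' ix' jy'].
rewrite /box_a /box_b /box_c /box_point /= => -[ei ej] [ei' ej'].
have xx : x' = x by apply: val_inj => /=; lia.
have ii : i' = i by apply: val_inj => /=; lia.
have [rr jj yy] : [/\ rho' = rho, (j' = j :> nat) & (y' = y :> nat)].
  case/and3P: cxy => /= _ y0 _; case/and3P: cxy' => /= _ y0' _.
  by case: (rho) (rho') ej ej' => -[] *; split => //; lia.
have {}yy : y' = y by apply: val_inj.
have {}jj : j' = j by apply: val_inj.
subst => -[e1 e2]; congr (_, (_, _)).
apply/eqP/negPn/negP => ss.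
have := box_apex_neq cxy; have := @box_apexP x y true cxy.
have := @box_apexP x y false cxy.
case: sigma sigma' ss e1 e2 => -[] //= _;
case: (box_apex x y true) => s u; case: (box_apex x y false) => s' u' /=;
by move=> e1 e2 [_ uy' _] [_ uy _]; apply; congr (_, _); case: (rho) e2 => *; lia.
Qed.

Lemma box_triangle_min t n : grid_side n = k -> box_ok t ->
  box_triangle t \in min_area_triangles (grid R n).
Proof.
move=> nk; case: t => [[[x y] [i j]] [rho sigma]] /and3P[/= cxy ix jy].
have inG p : (p.1 <= x)%N -> (p.2 <= y)%N ->
    nat_point (box_point (x, y, (i, j), (rho, sigma)) p) \in grid R n.
  move=> px py; apply/mem_grid; eexists; first by [].
  by rewrite nk /box_point /=; case: (rho); apply/andP; split; lia.
have := @box_apexP x y sigma cxy; rewrite /box_triangle /box_c /=.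
case: (box_apex x y sigma) => s u [sx uy h].
apply: half_area_triangle_min; [exact: inG | exact: inG | exact: inG |].
rewrite /area /box_a /box_b /box_point /nat_point /=; congr (_ / 2).
have hR : (x%:R * u%:R - y%:R * s%:R : R) = if sigma then 1 else -1.
  by case: (sigma) h => [h|h]; [have := congr1 (fun m => m%:R : R) h
    | have := congr1 (fun m => m%:R : R) h]; rewrite natrD !natrM; lra.
have e : `|x%:R * u%:R - y%:R * s%:R : R| = 1 by rewrite hR; case: (sigma); rewrite ?normrN normr1.
rewrite -[RHS]e; case: rho {inG}.
  rewrite subn0 subnn -normrN -!natr1 !natrD natrB //.
  by apply: (congr1 Num.norm); ring.
by rewrite -!natr1 !natrD; apply: (congr1 Num.norm); ring.
Qed.

Lemma count_shift x : (\sum_(i < k) (i + x < k) = k - x)%N.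
Proof.
rewrite -(big_mkord xpredT (fun i => (i + x < k)%N : nat)).
rewrite (@big_cat_nat _ _ _ (k - x)) ?leq_subr //=.
rewrite (@eq_big_nat _ _ _ 0 (k - x) _ (fun=> 1%N)); last first.
  by move=> i /andP[_ ik]; have -> : (i + x < k)%N by lia.
rewrite (@eq_big_nat _ _ _ (k - x) k _ (fun=> 0%N)); last first.
  by move=> i /andP[ik _]; have /negbTE -> : ~~ (i + x < k)%N by lia.
by rewrite !sum_nat_const_nat muln1 muln0 subn0 addn0.
Qed.

(** A box of size x by y has (k - x)(k - y) positions, with two diagonals and two sides each. *)
Lemma card_box_ok : (#|box_ok|)%:R = 4 * coprime_weight k (k%:R : R).
Proof.
have -> : #|box_ok| = (4 * \sum_(p : 'I_k.+1 * 'I_k.+1 |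
    coprime_pos (p.1 : nat, p.2 : nat)) (k - p.1) * (k - p.2))%N.
  rewrite -sum1_card big_mkcond /=.
  rewrite -(pair_bigA _ (fun q b => if (q, b) \in box_ok then 1%N else 0%N)) /=.
  rewrite -(pair_bigA _ (fun p q =>
    \sum_(b : bool * bool) if (p, q, b) \in box_ok then 1 else 0)%N) /=.
  rewrite big_distrr [RHS]big_mkcond /=; apply: eq_bigr => -[x y] _ /=.
  case: ifP => cxy; last first.
    rewrite big1 // => q _; rewrite big1 // => b _.
    by rewrite unfold_in /box_ok /= cxy.
  rewrite -!count_shift big_distrlr /= [in RHS]pair_bigA /= [in RHS]big_distrr /=.
  apply: eq_bigr => -[i j] _.
  rewrite (eq_bigr (fun=> ((i + x < k) * (j + y < k))%N)); last first.
    move=> b _; rewrite unfold_in /box_ok /= cxy /=.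
    by case: (_ < _)%N; case: (_ < _)%N.
  by rewrite sum_nat_const card_prod card_bool.
rewrite natrM natr_sum; congr (_ * _); apply: eq_bigr => -[x y] _ /=.
rewrite natrM; have tE (z : 'I_k.+1) : (k - z)%:R = tent (k%:R : R) z.
  have zk : (z <= k)%N by rewrite -ltnS.
  by rewrite natrB // /tent; apply/esym/max_idPr; rewrite subr_ge0 ler_nat.
by rewrite !tE.
Qed.

End BoxTriangles.

Lemma card_grid_min_ge n :
  4 * coprime_weight (grid_side n) ((grid_side n)%:R : R) <=
    (#|` min_area_triangles (grid R n)|)%:R.
Proof.
rewrite -card_box_ok ler_nat.
rewrite cardE -(size_map (@box_triangle _)); apply: uniq_leq_size => [|T].
  rewrite map_inj_in_uniq ?enum_uniq // => t t'; rewrite !mem_enum.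
  exact: box_triangle_inj.
by move=> /mapP[t]; rewrite mem_enum => okt ->; exact: box_triangle_min.
Qed.

End Grid.

(** * Asymptotics of the grid count and conclusion *)

Lemma coprime_weight_ge (R : realType) (e : R) : 0 < e ->
  exists K : nat, forall k : nat, (K <= k)%N ->
    (coprime_density R - e) * k%:R ^+ 4 <= coprime_weight k (k%:R : R).
Proof.
move=> e0; have [T0 [T01 H]] := eventually_small_error_all e0.
exists (Num.truncn T0).+1 => k Kk.
have : T0 <= (k%:R : R) <= (k%:R : R).
  apply/andP; split=> //; apply: ltW; apply: lt_le_trans (truncnS_gt _) _.
  by rewrite ler_nat.
move=> /H; rewrite ler_norml /coprime_error => /andP[h _]; lra.
Qed.

Lemma grid_min_triangles_asymptotic (R : realType) (e : R) : 0 < e ->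
  exists N0 : nat, forall n : nat, (N0 <= n)%N ->
    (6 / pi ^+ 2 - e) * n%:R ^+ 2 <= (#|` min_area_triangles (grid R n)|)%:R.
Proof.
move=> e0; have e80 : 0 < e / 8 by lra.
(* After the factor 4 this costs e / 2; the other half of [e] pays for replacing (k + 1)^4 by
   k^4. *)
have [K HK] := coprime_weight_ge e80.
have /andP[c0 c1] := coprime_density_bounds R.
have cE : 6 / pi ^+ 2 = 4 * coprime_density R.
  have : (pi : R) != 0 by rewrite lt0r_neq0 ?pi_gt0.
  by rewrite /coprime_density; move: (pi : R) => p p0; field.
(* From n >= B^2 follows k + 1 >= B, hence k >= K and e (k + 1) >= 32; the latter makes 16 (k + 1)^3
   at most (e / 2) (k + 1)^4. *)
pose B := (K + Num.truncn (32 / e)).+2.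
exists (B * B)%N => n Bn.
set t := (#|` _|)%:R.
have t0 : 0 <= t by apply: ler0n.
(* The coefficient must be positive before n^2 can be replaced by its upper bound (k + 1)^4. *)
have [neg | pos] := leP (6 / pi ^+ 2 - e) 0.
  by apply: le_trans t0; rewrite mulr_le0_ge0 // exprn_ge0.
rewrite {}cE in pos *.
have := card_grid_min_ge R n; rewrite -/t; set k := grid_side R n => ht.
have nk : n%:R <= k.+1%:R ^+ 2 :> R := grid_side_sqrS_ge R n.
have Bk : (B <= k.+1)%N.
  rewrite -leq_sqr -!mulnn; apply: leq_trans Bn _.
  by rewrite -(ler_nat R) natrM -expr2.
have Kk : (K <= k)%N by rewrite /B in Bk; lia.
have /HK hk := Kk.
have ek : 32 / e <= k.+1%:R.
  apply: ltW; apply: lt_le_trans (truncnS_gt _) _; rewrite ler_nat.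
  by apply: leq_trans Bk; rewrite /B ltnS leqW // leq_addl.
have n2 : n%:R ^+ 2 <= k.+1%:R ^+ 4 :> R.
  by rewrite (_ : 4 = 2 * 2)%N // exprM lerXn2r ?nnegrE ?exprn_ge0.
apply: le_trans (ler_wpM2l (ltW pos) n2) _.
apply: le_trans ht; rewrite -natr1 in ek; rewrite -[k.+1%:R]natr1.
set m : R := k%:R in hk ek *.
have m0 : 0 <= m by apply: ler0n.
have em : 32 <= e * (m + 1) by move: ek; rewrite ler_pdivrMr //; lra.
have m4 : (m + 1) ^+ 4 - 4 * (m + 1) ^+ 3 <= m ^+ 4.
  rewrite -subr_ge0.
  have -> : m ^+ 4 - ((m + 1) ^+ 4 - 4 * (m + 1) ^+ 3) = 6 * (m + 1) ^+ 2 - 4 * (m + 1) + 1 by ring.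
  nra.
have p3 : 0 <= (m + 1) ^+ 3 by rewrite exprn_ge0 // addr_ge0.
have em4 : 32 * (m + 1) ^+ 3 <= e * (m + 1) ^+ 4.
  have -> : e * (m + 1) ^+ 4 = e * (m + 1) * (m + 1) ^+ 3 by ring.
  by rewrite ler_wpM2r.
have h1 : (coprime_density R - e / 8) * ((m + 1) ^+ 4 - 4 * (m + 1) ^+ 3) <=
          (coprime_density R - e / 8) * m ^+ 4.
  by rewrite ler_wpM2l //; lra.
have cp3 : coprime_density R * (m + 1) ^+ 3 <= (m + 1) ^+ 3 by rewrite ler_piMl.
have ep3 : 0 <= e * (m + 1) ^+ 3 by rewrite mulr_ge0 // ltW.
move: hk em4 h1 cp3 ep3.
move: (coprime_density R) (coprime_weight _ _) ((m + 1) ^+ 4) ((m + 1) ^+ 3).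
by move: (m ^+ 4) => p4 c w q4 q3; lra.
Qed.

Theorem theorem3 (R : realType) :
  (forall (n : nat) (S : {fset R * R}),
      #|` S| = n -> ~ on_a_line S ->
      (#|` min_area_triangles S|)%:R <= 2 / 3 * (n%:R ^+ 2 - n%:R) :> R) /\
  ((forall n : nat, (1 <= n)%N -> (#|` grid R n| <= n)%N) /\
   exists eps : nat -> R,
     (eps n @[n --> \oo] --> (0 : R)) /\
     forall n : nat, (1 <= n)%N ->
       (6 / pi ^+ 2 - eps n) * n%:R ^+ 2 <=
         (#|` min_area_triangles (grid R n)|)%:R).
Proof.
split=> [n S Sn _ | ].
  have := card_min_area_triangles_le S; rewrite Sn -(ler_nat R) !natrM.
  (* The truncated predecessor differs from n - 1 at n = 0, which is treated apart. *)
  case: n Sn => [|m] _ /=; first by rewrite mul0r mulr0 expr0n /=; lra.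
  by rewrite -[m.+1%:R]natr1; lra.
split=> [n _ | ]; first exact: card_grid_le.
pose t n : R := (#|` min_area_triangles (grid R n)|)%:R.
(* The least nonnegative choice for n >= 1; the maximum with 0 reduces convergence to an upper
   bound. *)
exists (fun n => Num.max 0 (6 / pi ^+ 2 - t n / n%:R ^+ 2)); split; last first.
  move=> n n1; have n0 : (0 : R) < n%:R ^+ 2 by rewrite exprn_gt0 // ltr0n.
  rewrite -ler_pdivlMr // lerBlDr -lerBlDl le_max; apply/orP; right.
  by rewrite -/(t n).
apply/cvgrPdist_le => e e0; have [N0 H] := grid_min_triangles_asymptotic e0.
exists (maxn N0 1) => // n /=; rewrite geq_max => /andP[/H hn n1].
have n0 : (0 : R) < n%:R ^+ 2 by rewrite exprn_gt0 // ltr0n.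
rewrite sub0r normrN ger0_norm ?le_max ?lexx // ge_max (ltW e0) /=.
by move: hn; rewrite -ler_pdivlMr // -/(t n); lra.
Qed.
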